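(* There exists a graph $G$ with no strongly minimal colouring, i.e. there is no family $\mathcal{C}$ of independent sets of $G$ whose union is $V(G)$ such that for every family $\mathcal{C}'$ of independent sets of $G$ whose union is $V(G)$ we have $|\mathcal{C}\setminus\mathcal{C}'|\leq|\mathcal{C}'\setminus\mathcal{C}|$.
   Context: Graphs may be infinite. A strongly minimal colouring of a graph $G$ is a strongly minimal cover of the vertex set by independent sets: a family $\mathcal{C}$ of independent sets covering $V(G)$ such that every other family $\mathcal{C}'$ of independent sets covering $V(G)$ satisfies $|\mathcal{C}\setminus\mathcal{C}'|\leq|\mathcal{C}'\setminus\mathcal{C}|$ (comparison of cardinalities). *)

(* Defs.v *)
From mathcomp Require Import all_boot all_classical.

Set Implicit Arguments.
Unset Strict Implicit.
Unset Printing Implicit Defensive.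

Local Open Scope classical_set_scope.
Local Open Scope card_scope.

(* Simple undirected graphs, possibly infinite. *)
Record graph := Graph {
  vertex :> Type;
  adj : vertex -> vertex -> Prop;
  adj_sym : forall x y, adj x y -> adj y x;
  adj_irrefl : forall x, ~ adj x x
}.

Definition independent (G : graph) (A : set G) : Prop :=
  forall x y, A x -> A y -> ~ adj x y.

(* Colour classes may overlap, and the empty class is allowed. *)
Definition colouring (G : graph) (C : set (set G)) : Prop :=
  (forall A, C A -> independent A) /\ \bigcup_(A in C) A = setT.

Definition strongly_minimal_colouring (G : graph) (C : set (set G)) : Prop :=
  colouring C /\
  forall C' : set (set G), colouring C' -> C `\` C' #<= C' `\` C.

(* Main.v *)
(* In the graph below the vertices [host i n] form a clique, so in a colouring
   they get pairwise distinct classes, and only [target i] and [token i n] may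
   join the class of [host i n], though not together.  Hence if [target i]
   joins the class of [host i n], then [token i n] is left over, and tokens are
   adjacent in such a way that a class containing no host only meets finitely
   many rows [i].  So every colouring has infinitely many classes other than
   the chosen classes of the hosts.  However, the first [M] rows can always be
   served by a single extra class, namely the tokens [(i, n)] with
   [i < M <= n], after recolouring only finitely many host classes.  So any two
   extra classes of a colouring can be traded for one. *)
Require Import Defs.
From mathcomp Require Import all_boot all_classical finmap zify.

Local Open Scope classical_set_scope.
Local Open Scope card_scope.

Lemma card_le_fset (T : choiceType) (X Y : {fset T}) :
  [set` X] #<= [set` Y] -> #|` X| <= #|` Y|.
Proof.
have eqX : [set` X] #= `I_(#|` X|) by apply/card_eq_fsetP.
have eqY : [set` Y] #= `I_(#|` Y|) by apply/card_eq_fsetP.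
by rewrite (card_le_eql eqX) (card_le_eqr eqY) card_le_II.
Qed.

(** Trading the classes in [s] for those in [t] gives a colouring [C'] that differs from [C] only by
    finite sets: [C] loses [s] minus [t] and gains at most [t] minus [s]. Minimality compares these
    two, and adding back the common part compares [s] with [t]. *)
Lemma strongly_minimal_swap (G : graph) (C : set (set G)) (s t : seq (set G)) :
  strongly_minimal_colouring C -> uniq s ->
  (forall A, A \in s -> C A) -> (forall B, B \in t -> independent B) ->
  (forall A x, A \in s -> A x -> exists2 B, B \in t & B x) ->
  size s <= size t.
Proof.
move=> [[Cind Ccov] Cmin] us sC tind cov.
pose C' : set (set G) := (C `\` [set` s]) `|` [set` t].
have colC' : colouring C'.
  split=> [A [[/Cind//]|/tind//]|].
  apply/seteqP; split=> // x _.
  have [A CA Ax] : (\bigcup_(A in C) A) x by rewrite Ccov.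
  have [As|As] := boolP (A \in s).
    by have [B Bt Bx] := cov _ _ As Ax; exists B => //; right.
  by exists A => //; left; split=> //=; apply/negP.
pose S := seq_fset tt s; pose T := seq_fset tt t.
have leST : [set` (S `\` T)%fset] #<= [set` (T `\` S)%fset].
  apply: (card_le_trans _ (card_le_trans (Cmin _ colC') _));
    apply: subset_card_le => A /=; rewrite !inE !seq_fsetE.
    by move=> /andP[/negP At As]; split; [exact: sC|case=> [[_ /(_ As)]|]].
  move=> [[[CA _ /(_ CA)]//|At] nCA]; rewrite At andbT.
  by apply/negP=> /sC.
have cardS : #|` S| = size s.
  by rewrite size_seq_fset undup_id.
have cardT : #|` T| <= size t.
  by rewrite size_seq_fset size_undup.
move: (card_le_fset _ _ _ leST); rewrite !cardfsD fsetIC.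
have := fsubset_leq_card (fsubsetIl T S).
have := fsubset_leq_card (fsubsetIr T S).
lia.
Qed.

Inductive vtx :=
  | host of nat & nat
  | target of nat
  | token of nat & nat.

(** The graph is given through its complement, so that colour classes are cliques of the symmetrised
    [share]. *)
Definition share (x y : vtx) : Prop :=
  match x, y with
  | host i _, target j => i = j
  | host i n, token j m => i = j /\ n = m
  | token i n, token j m => j < n /\ i < m
  | _, _ => False
  end.

Definition conflict (x y : vtx) : Prop :=
  [/\ x <> y, ~ share x y & ~ share y x].

Lemma conflict_sym x y : conflict x y -> conflict y x.
Proof. by case=> xy sxy syx; split=> // /esym. Qed.

Lemma conflict_irrefl x : ~ conflict x x.
Proof. by case. Qed.

Definition rows := Graph conflict_sym conflict_irrefl.

Lemma independent_share (A : set rows) x y :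
  independent A -> A x -> A y -> [\/ x = y, share x y | share y x].
Proof.
move=> Aind Ax Ay; apply: contrapT => nxy.
apply: (Aind x y) => //; split=> h; apply: nxy.
- by constructor 1.
- by constructor 2.
- by constructor 3.
Qed.

(** Hosts count both indices, so only finitely many lie below a given level. Tokens count only their
    row, since a class such as [late_tokens M] meets infinitely many columns. *)
Definition level (x : vtx) : nat :=
  match x with
  | host i n => maxn i n
  | target i => i
  | token i _ => i
  end.

Lemma independent_bounded (A : set rows) :
  independent A -> exists M, forall x, A x -> level x < M.
Proof.
move=> Aind.
have shareA := independent_share A _ _ Aind.
have [[i [n Ax]]|Anohost] := pselect (exists i n, A (host i n)).
  exists (maxn i n).+1 => y /(shareA _ _ Ax) [<-//||]; case: y => //= *; lia.
have [[x Ax]|A0] := pselect (exists x, A x); last first.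
  by exists 0 => x Ax; case: A0; exists x.
(* A companion of [token i n] is a token in a row below [n], hence the column enters the bound. *)
exists (match x with token i n => maxn i n | _ => level x end).+1 => y Ay.
case: (shareA _ _ Ax Ay) => [<-||]; case: x Ax => [i n|i|i n] Ax //=;
  try by case: Anohost; exists i, n.
- by lia.
- by case: y Ay => //= *; lia.
- by case: y Ay => //= j m Ay; case: Anohost; exists j, m.
- by case: y Ay => //= *; lia.
Qed.

(** Otherwise [target M] lies in some [K M n]. Then [token M n] must lie in that same class,
    although a target and a token always conflict. *)
Lemma extra_class (C : set (set rows)) (K : nat -> nat -> set rows) (M : nat) :
  colouring C -> (forall i n, K i n (host i n)) ->
  exists E, [/\ C E, forall i n, E <> K i n & exists2 x, E x & M <= level x].
Proof.
move=> [Cind Ccov] Khost; apply: contrapT => noE.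
have inK A x : C A -> A x -> M <= level x -> exists i n, A = K i n.
  move=> CA Ax Mx; apply: contrapT => nK; apply: noE; exists A; split=> //.
    by move=> i n eqA; apply: nK; exists i, n.
  by exists x.
have cover x : exists2 A, C A & A x by have := I : setT x; rewrite -Ccov.
have [A CA Ax] := cover (target M).
have [i [n eqA]] := inK _ _ CA Ax (leqnn M).
have hA : A (host i n) by rewrite eqA.
have eqi : i = M by case: (independent_share _ _ _ (Cind _ CA) hA Ax).
have [B CB Bx] := cover (token M n).
have [j [m eqB]] := inK _ _ CB Bx (leqnn M).
have hB : B (host j m) by rewrite eqB.
have [eqj eqm] : j = M /\ m = n.
  by case: (independent_share _ _ _ (Cind _ CB) hB Bx).
have eqAB : A = B by rewrite eqA eqB eqi eqj eqm.
rewrite -eqAB in Bx.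
by case: (independent_share _ _ _ (Cind _ CA) Ax Bx).
Qed.

Definition late_tokens (M : nat) : set rows :=
  fun x => if x is token i n then i < M <= n else False.

Definition new_host_class (M : nat) (p : nat * nat) : set rows :=
  fun x => x = host p.1 p.2 \/
           x = if p.2 < M then token p.1 p.2 else target p.1.

Lemma late_tokens_independent M : independent (late_tokens M).
Proof.
by move=> [i n|i|i n] [j m|j|j m] //= hi hj [_ ns _]; apply: ns => /=; lia.
Qed.

Lemma new_host_class_independent M p : independent (new_host_class M p).
Proof.
rewrite /new_host_class => x y; case: ifP => _ [->|->] [->|->] [ne ns ns'];
  by [apply: ne|apply: ns|apply: ns'].
Qed.

Theorem theorem1p5 :
  exists G : graph,
    ~ exists C : set (set G), strongly_minimal_colouring C.
Proof.
exists rows => -[C Cmin]; have [Ccol _] := Cmin; have [Cind Ccov] := Ccol.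
have hostK p : exists A : set rows, C A /\ A (host p.1 p.2).
  have : (\bigcup_(A in C) A) (host p.1 p.2 : rows) by rewrite Ccov.
  by case=> A CA Ap; exists A.
have [K0 hK0] := choice hostK; pose K i n := K0 (i, n).
have CK i n : C (K i n) by have [] := hK0 (i, n).
have Khost i n : K i n (host i n) by have [] := hK0 (i, n).
have Ksub i n x : K i n x -> [\/ x = host i n, x = target i | x = token i n].
  move=> Kx; have := independent_share _ _ _ (Cind _ (CK i n)) (Khost i n) Kx.
  case=> [<-||]; first by constructor 1.
    by case: x {Kx} => //= [j <-|j m [<- <-]]; [constructor 2|constructor 3].
  by case: x {Kx}.
(* Level 0 imposes nothing on [E1]; [E2] is then taken to reach beyond all levels of [E1], which
   makes it a different class. *)
have [E1 [CE1 E1K _]] := extra_class C K 0 Ccol Khost.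
have [M1 E1M] := independent_bounded _ (Cind _ CE1).
have [E2 [CE2 E2K [y E2y My]]] := extra_class C K M1 Ccol Khost.
have [M2 E2M] := independent_bounded _ (Cind _ CE2).
have neqE : E1 <> E2 by move=> eqE; have := E1M y; rewrite eqE => /(_ E2y); lia.
pose M := maxn M1 M2.
(* Each row below [M] uses [M.+1] hosts: columns below [M] take their own tokens, and column [M]
   takes the target. The remaining tokens of the row go to [late_tokens M]. *)
pose box := [seq (i, n) | i <- iota 0 M, n <- iota 0 M.+1].
have boxP i n : (i, n) \in box = (i < M) && (n <= M).
  apply/allpairsP/andP=> [[[j m] [jM mM [-> ->]]]|[iM nM]].
    by move: jM mM; rewrite !mem_iota => /andP[_ ->] /andP[_].
  by exists (i, n); rewrite !mem_iota !add0n ltnS iM nM.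
pose s := [:: E1, E2 & [seq K0 p | p <- box]].
pose t := late_tokens M :: [seq new_host_class M p | p <- box].
suff : size s <= size t by rewrite /= !size_map ltnn.
have KE E : (forall i n, E <> K i n) -> E \notin [seq K0 p | p <- box].
  by move=> EK; apply/mapP => -[[i n] _]; exact: EK.
apply: (strongly_minimal_swap _ C) => //.
- rewrite /= inE negb_or !KE // andbT; apply/andP; split; first exact/eqP.
  (* By [Ksub], [K i n] contains no host but [host i n], so [K0] is injective. *)
  rewrite map_inj_uniq.
    by apply: allpairs_uniq; rewrite ?iota_uniq // => -[? ?] [? ?] _ _ [-> ->].
  move=> [i n] [j m] eqK; have := Khost j m; rewrite /K -eqK => /Ksub.
  by case=> // -[-> ->].
- move=> A; rewrite !inE => /or3P[/eqP->|/eqP->|/mapP[[i n] _ ->]] //; exact: CK.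
- move=> B; rewrite inE => /orP[/eqP->|/mapP[p _ ->]].
    exact: late_tokens_independent.
  exact: new_host_class_independent.
have newP i n : i < M -> n <= M -> new_host_class M (i, n) \in t.
  by move=> iM nM; rewrite inE map_f ?orbT // boxP iM.
have targetP i : i < M -> exists2 B, B \in t & B (target i).
  by move=> iM; exists (new_host_class M (i, M)); [exact: newP|right; rewrite ltnn].
have hostP i n : i < M -> n <= M -> exists2 B, B \in t & B (host i n).
  by move=> iM nM; exists (new_host_class M (i, n)); [exact: newP|left].
have tokenP i n : i < M -> exists2 B, B \in t & B (token i n).
  move=> iM; have [nM|Mn] := ltnP n M.
    by exists (new_host_class M (i, n)); [exact/newP/ltnW|right; rewrite nM].
  by exists (late_tokens M); rewrite ?inE ?eqxx //= iM.
have low x : level x < M -> exists2 B, B \in t & B x.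
  case: x => [i n|i|i n] /= lx; [apply: hostP; lia|exact: targetP|exact: tokenP].
move=> A x; rewrite !inE => /or3P[/eqP-> /E1M|/eqP-> /E2M|].
- by move=> lx; apply: low; lia.
- by move=> lx; apply: low; lia.
case/mapP=> [[i n]]; rewrite boxP => /andP[iM nM] -> /Ksub.
by case=> ->; [exact: hostP|exact: targetP|exact: tokenP].
Qed.
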